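(* Let $A$ be a finite-dimensional basic algebra over an algebraically closed field $\Bbbk$, and let $X$ be a finite-dimensional left $A$-module. Then the function $\operatorname{JF}$ on $\operatorname{NEnd}(X)$ has a maximum value with respect to componentwise dominance order (i.e. there is ${\boldsymbol\mu}$ with $\operatorname{JF}(N)\le{\boldsymbol\mu}$ for all $N\in\operatorname{NEnd}(X)$), and the set of $N\in\operatorname{NEnd}(X)$ with $\operatorname{JF}(N)={\boldsymbol\mu}$ is a dense open subset of $\operatorname{NEnd}(X)$.
   Context: $A$ is identified with a quiver $Q$ with relations (vertices $1,\dots,n$ corresponding to a complete set of primitive orthogonal idempotents $e_i$), so $X$ corresponds to a representation with vector spaces $X_i=e_iX$ of dimension $d_i$. $\operatorname{NEnd}(X)$ is the variety of nilpotent $A$-module endomorphisms of $X$. For $N\in\operatorname{NEnd}(X)$, $N_i$ is the induced operator on $X_i$, $\operatorname{JF}(N_i)\vdash d_i$ the partition of Jordan block sizes, and $\operatorname{JF}(N)=(\operatorname{JF}(N_i))_i$. For partitions $\gamma,\kappa$ of the same integer, $\gamma\le\kappa$ in dominance order if $\gamma_1+\dots+\gamma_k\le\kappa_1+\dots+\kappa_k$ for all $k$; for tuples, ${\boldsymbol\lambda}\le{\boldsymbol\mu}$ iff $\lambda^i\le\mu^i$ for every $i$. *)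

(* Defs.v *)
From mathcomp Require Import all_boot all_order all_algebra.
Set Implicit Arguments. Unset Strict Implicit. Unset Printing Implicit Defensive.
Import Order.TTheory GRing.Theory.

Local Open Scope ring_scope.

(* ---------- Representations of a finite quiver ----------
   Vertices: 'I_n ; dimension vector d ; arrows: 'I_m.
   The arrow a : src a -> tgt a acts by rho a (src a) (tgt a) : 'M_(d (src a), d (tgt a))
   (row-vector convention: v in X_i is sent to v *m rho a i j);
   all other components rho a i j are required to be zero. *)

Section Quiver.
Variables (F : fieldType) (n m : nat) (d : 'I_n -> nat).
Variable rho : 'I_m -> forall i j : 'I_n, 'M[F]_(d i, d j).

(* action of the path given by a sequence of arrows (first arrow first),
   as a block (i,j) component; zero if the path is not composable *)
Fixpoint path_act (s : seq 'I_m) : forall i j : 'I_n, 'M[F]_(d i, d j) :=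
  match s with
  | [::] => fun i j => if i == j then pid_mx (d i) else 0
  | a :: s' => fun i j => \sum_(k < n) rho a i k *m path_act s' k j
  end.

Definition is_endo (N : forall i : 'I_n, 'M[F]_(d i)) : Prop :=
  forall (a : 'I_m) (i j : 'I_n), rho a i j *m N j = N i *m rho a i j.

Definition NEnd (N : forall i : 'I_n, 'M[F]_(d i)) : Prop :=
  is_endo N /\ exists k : nat, forall i : 'I_n, N i ^+ k = 0.

Inductive is_polyfun : ((forall i : 'I_n, 'M[F]_(d i)) -> F) -> Prop :=
  | polyfun_const (c : F) : is_polyfun (fun _ => c)
  | polyfun_coord (i : 'I_n) (p q : 'I_(d i)) : is_polyfun (fun N => N i p q)
  | polyfun_add f g : is_polyfun f -> is_polyfun g -> is_polyfun (fun N => f N + g N)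
  | polyfun_mul f g : is_polyfun f -> is_polyfun g -> is_polyfun (fun N => f N * g N).

Definition zopen_in (V U : (forall i : 'I_n, 'M[F]_(d i)) -> Prop) : Prop :=
  exists S : ((forall i : 'I_n, 'M[F]_(d i)) -> F) -> Prop,
    (forall f, S f -> is_polyfun f) /\
    (forall N, U N <-> (V N /\ exists f, S f /\ f N <> 0)).

Definition zdense_in (V U : (forall i : 'I_n, 'M[F]_(d i)) -> Prop) : Prop :=
  (forall N, U N -> V N) /\
  (forall W, zopen_in V W -> (exists N, W N) -> exists N, W N /\ U N).

End Quiver.

Definition is_partition (lam : seq nat) : bool :=
  sorted geq lam && all (fun x => 0 < x)%N lam.

(* nilpotent Jordan matrix with block sizes lam (in order) *)
Definition jordan_nil (F : fieldType) (lam : seq nat) : 'M[F]_(sumn lam) :=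
  \matrix_(p, q)
    (((q : nat) == p.+1) &&
     (p.+1 \notin [seq sumn (take k lam) | k <- iota 1 (size lam)]))%:R.

Definition is_JF (F : fieldType) (k : nat) (M : 'M[F]_k) (lam : seq nat) : Prop :=
  is_partition lam /\
  exists (P : 'M[F]_(k, sumn lam)) (Q : 'M[F]_(sumn lam, k)),
    P *m Q = 1%:M /\ Q *m P = 1%:M /\ M = P *m jordan_nil F lam *m Q.

Definition dominates (lam mu : seq nat) : Prop :=
  sumn lam = sumn mu /\ forall k : nat, (sumn (take k lam) <= sumn (take k mu))%N.

(* Main.v *)
(* The nilpotent endomorphisms form an irreducible variety. The algebra [A] of
   endomorphisms maps onto a product of full matrix algebras with nil kernel
   (Burnside's theorem on the composition factors), and the elements with
   strictly triangular images form a linear space [n] of nilpotents. Units lift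
   along this map, so every nilpotent of [A] is conjugate into [n] under the units of
   [A]; letting the conjugating unit and the element of [n] vary affinely in [t]
   joins two nilpotents by a polynomial curve that lies generically in [NEnd].
   The ranks of the powers [N i ^+ k] are lower semicontinuous, hence they reach
   their maxima simultaneously on a dense open set, and these ranks determine
   the Jordan types and compare them for dominance. *)
From Stdlib Require Import Classical List FunctionalExtensionality.
Require Import Defs.
From mathcomp Require Import all_boot all_order all_algebra.
Set Implicit Arguments.
Unset Strict Implicit.
Unset Printing Implicit Defensive.
Import GRing.Theory.
Local Open Scope ring_scope.

(** * Jordan forms of nilpotent matrices *)

Section NilpotentMatrices.

Variable F : fieldType.

Definition nilmx n (M : 'M[F]_n) := exists k : nat, M ^+ k = 0.

Definition strict_trigmx n (M : 'M[F]_n) := forall i j : 'I_n, (j <= i)%N -> M i j = 0.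

Lemma exp_intertwine m n (P : 'M[F]_(m, n)) (X : 'M[F]_m) (Y : 'M[F]_n) k :
  X *m P = P *m Y -> X ^+ k *m P = P *m Y ^+ k.
Proof.
move=> XP; elim: k => [|k IHk]; first by rewrite !expr0 mulmx1 mul1mx.
by rewrite !exprSr -!mulmxE -mulmxA XP mulmxA IHk -mulmxA.
Qed.

Lemma exp_conjmx m n (P : 'M[F]_(m, n)) (Q : 'M[F]_(n, m)) (Y : 'M[F]_n) k :
  P *m Q = 1%:M -> Q *m P = 1%:M -> (P *m Y *m Q) ^+ k = P *m Y ^+ k *m Q.
Proof.
move=> PQ QP; rewrite -(exp_intertwine (X := P *m Y *m Q)) -?mulmxA ?QP ?mulmx1 //.
by rewrite PQ mulmx1.
Qed.

Lemma nilmx_leq n (M : 'M[F]_n) k l : (k <= l)%N -> M ^+ k = 0 -> M ^+ l = 0.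
Proof. by move=> /subnK <- Mk; rewrite exprD Mk -mulmxE mulmx0. Qed.

Lemma strict_trigmx_nil n (M : 'M[F]_n) : strict_trigmx M -> nilmx M.
Proof.
move=> tM; exists n.
have tMk k : forall i j : 'I_n, (j < i + k)%N -> (M ^+ k) i j = 0.
  elim: k => [|k IHk] i j lji.
    by rewrite expr0 mxE; case: eqP lji => // ->; rewrite addn0 ltnn.
  rewrite exprSr -mulmxE mxE big1 // => l _.
  case: (ltnP l (i + k)) => [/IHk->|lil]; first by rewrite mul0r.
  by rewrite tM ?mulr0 // (leq_trans _ lil) // -ltnS -addnS.
by apply/matrixP=> i j; rewrite tMk ?mxE // ltn_addl.
Qed.

(** A row vector killed by [M] is an eigenvector of [M - 1%:M] for the eigenvalue [-1], which a
    nilpotent matrix does not have. *)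
Lemma nilmx_unit1 n (M : 'M[F]_n) : nilmx (M - 1%:M) -> M \in unitmx.
Proof.
case=> k Mk; rewrite -row_free_unit -kermx_eq0; apply: contraT => /rowV0Pn[v].
move/sub_kermxP => vM v0; have := exp_intertwine k (_ : (-1)%:M *m v = v *m (M - 1%:M)).
rewrite Mk mulmx0 -rmorphXn /= mul_scalar_mx => /(_ _)/eqP.
rewrite scaler_eq0 signr_eq0 (negPf v0); apply.
by rewrite mul_scalar_mx mulmxBr vM mulmx1 sub0r scaleN1r.
Qed.

End NilpotentMatrices.

(** * Ranks of the powers of nilpotent Jordan matrices *)

Section JordanRanks.

Variable F : fieldType.

(** For [k = 1] this is the nilpotent Jordan block of size [a]; larger [k] give its powers. *)
Definition shiftmx a k : 'M[F]_a := \matrix_(p, q) ((q : nat) == (p + k)%N)%:R.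

Lemma exp_shiftmx a k : shiftmx a 1 ^+ k = shiftmx a k.
Proof.
elim: k => [|k IHk]; first by apply/matrixP=> i j; rewrite !mxE addn0 eq_sym.
apply/matrixP=> i j; rewrite exprSr IHk -mulmxE !mxE.
case: (ltnP (i + k) a) => [lt_ik|le_a].
  rewrite (bigD1 (Ordinal lt_ik)) //= !mxE /= eqxx mul1r -addnA addn1 big1 ?addr0 //.
  by move=> l /negPf nl; rewrite mxE -[(l : nat) == _]/(l == Ordinal lt_ik) nl mul0r.
rewrite big1 => [|l _]; last first.
  by rewrite mxE ltn_eqF ?mul0r // (leq_trans (ltn_ord l)).
by rewrite ltn_eqF // (leq_trans (ltn_ord j)) // (leq_trans le_a) // addnS.
Qed.

(** Upper bound: the matrix factors through [pid_mx (a - k)]. Lower bound: its product with its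
    transpose is [pid_mx (a - k)]. *)
Lemma rank_shiftmx a k : \rank (shiftmx a k) = (a - k)%N.
Proof.
apply/eqP; rewrite eqn_leq; apply/andP; split.
  have -> : shiftmx a k = pid_mx (a - k) *m shiftmx a k.
    apply/matrixP=> i j; rewrite !mxE (bigD1 i) //= big1 => [|l /negPf nl]; last first.
      by rewrite mxE eq_sym -val_eqE /= in nl *; rewrite nl mul0r.
    rewrite addr0 !mxE eqxx /= ltn_subRL [(k + i)%N]addnC.
    case: ltnP => [|le_a]; first by rewrite mul1r.
    by rewrite mul0r ltn_eqF // (leq_trans (ltn_ord j)).
  apply: leq_trans (mxrankM_maxl _ _) _.
  by rewrite rank_pid_mx ?leq_subr.
have -> : (a - k)%N = \rank (shiftmx a k *m (shiftmx a k)^T).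
  rewrite -[LHS](@rank_pid_mx F a a) ?leq_subr //; congr mxrank.
  apply/matrixP=> i j; rewrite !mxE ltn_subRL [(k + i)%N]addnC.
  case: ltnP => [lt_ik|le_a].
    rewrite (bigD1 (Ordinal lt_ik)) //= !mxE /= eqxx mul1r eqn_add2r andbT big1 ?addr0 //.
    by move=> l /negPf nl; rewrite mxE -[(l : nat) == _]/(l == Ordinal lt_ik) nl mul0r.
  rewrite andbF big1 // => l _.
  by rewrite mxE ltn_eqF ?mul0r // (leq_trans (ltn_ord l)).
exact: mxrankM_maxl.
Qed.

Lemma jordan_nil_cons a lam :
  jordan_nil F (a :: lam) =
    block_mx (shiftmx a 1) 0 0 (jordan_nil F lam) :> 'M_(a + sumn lam).
Proof.
set s := [seq sumn (take k lam) | k <- iota 1 (size lam)].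
have bdry : [seq sumn (take k (a :: lam)) | k <- iota 1 (size lam).+1] =
            a :: [seq (a + x)%N | x <- s].
  have -> : iota 1 (size lam).+1 = 1%N :: [seq (1 + k)%N | k <- iota 1 (size lam)].
    by rewrite -iotaDl.
  by rewrite /= take0 addn0 -!map_comp; congr (_ :: _); apply: eq_map.
apply/matrixP=> p q; rewrite mxE bdry.
case: (split_ordP p) => p' ->; case: (split_ordP q) => q' ->;
  rewrite ?block_mxEul ?block_mxEur ?block_mxEdl ?block_mxEdr !mxE /= ?addn1.
- case: eqP => //= qp; congr (_%:R); rewrite inE negb_or.
  have lt_pa : (p'.+1 < a)%N by rewrite -qp.
  rewrite (ltn_eqF lt_pa) /=; apply/eqP; rewrite eqb1; apply/mapP => -[x _ pE].
  by move: lt_pa; rewrite pE ltnNge leq_addr.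
(* The only possible superdiagonal entry of the upper right corner is in row [a - 1], and the block
   boundary [a] suppresses it. *)
- case: eqP => //= qp; suff -> : p'.+1 = a by rewrite inE eqxx.
  by apply/eqP; rewrite eqn_leq ltn_ord -qp leq_addr.
- by rewrite ltn_eqF // (leq_trans (ltn_ord q')) // -addnS leq_addr.
- have neq_a : (a + p'.+1 == a)%N = false by rewrite -[eqbRHS]addn0 eqn_add2l.
  by rewrite -addnS eqn_add2l inE neq_a mem_map //; apply: addnI.
Qed.

Lemma exp_diag_block m n (A : 'M[F]_m) (B : 'M[F]_n) k :
  block_mx A 0 0 B ^+ k = block_mx (A ^+ k) 0 0 (B ^+ k) :> 'M_(m + n).
Proof.
elim: k => [|k IHk]; first by rewrite !expr0 -scalar_mx_block.
by rewrite !exprS IHk -!mulmxE mulmx_block !(mulmx0, mul0mx, addr0, add0r).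
Qed.

Lemma rank_exp_jordan_nil lam k :
  \rank (jordan_nil F lam ^+ k) = (\sum_(x <- lam) (x - k))%N.
Proof.
elim: lam => [|a lam IHl].
  by rewrite big_nil; apply/eqP; rewrite -leqn0 (leq_trans (rank_leq_row _)).
rewrite big_cons jordan_nil_cons.
by rewrite (exp_diag_block (shiftmx a 1)) rank_diag_block_mx exp_shiftmx rank_shiftmx IHl.
Qed.

Lemma jordan_nil_strict_trig lam : strict_trigmx (jordan_nil F lam).
Proof. by move=> i j le_ji; rewrite mxE ltn_eqF. Qed.

(** [is_JF] admits rectangular [P] and [Q], which avoids a cast; being mutually inverse forces the
    sizes to agree. *)
Lemma is_JF_sumn n (M : 'M[F]_n) lam : is_JF M lam -> sumn lam = n.
Proof.
case=> _ [P [Q [PQ [QP _]]]]; apply/eqP; rewrite eqn_leq.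
by rewrite (mulmx1_min QP) (mulmx1_min PQ).
Qed.

(** The sum counts the boxes of the Young diagram of [lam] beyond column [k]; conjugation does not
    change ranks. *)
Lemma rank_exp_JF n (M : 'M[F]_n) lam k :
  is_JF M lam -> \rank (M ^+ k) = (\sum_(x <- lam) (x - k))%N.
Proof.
case=> _ [P [Q [PQ [QP ->]]]]; rewrite exp_conjmx // -rank_exp_jordan_nil.
set J := _ ^+ k; apply/eqP; rewrite eqn_leq; apply/andP; split.
  exact: leq_trans (mxrankM_maxl _ _) (mxrankM_maxr _ _).
have {1}-> : J = Q *m (P *m J *m Q) *m P.
  by rewrite -!mulmxA QP mulmx1 mulmxA QP mul1mx.
exact: leq_trans (mxrankM_maxl _ _) (mxrankM_maxr _ _).
Qed.

Lemma is_JF_nil n (M : 'M[F]_n) lam : is_JF M lam -> M ^+ n = 0.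
Proof.
move=> JM; apply/eqP; rewrite -mxrank_eq0 (rank_exp_JF _ JM) -(is_JF_sumn JM).
rewrite big1_seq // => x /andP[_]; elim: lam {JM} => //= a lam IHl.
rewrite inE => /predU1P[->|/IHl]; first by apply/eqP; rewrite subn_eq0 leq_addr.
by move=> /eqP; rewrite subn_eq0 => xs; apply/eqP; rewrite subn_eq0 (leq_trans xs) ?leq_addl.
Qed.

End JordanRanks.

(** * Dominance of partitions from box counts *)

Section Dominance.

Local Open Scope nat_scope.

Lemma sumn_le_excess k (s : seq nat) :
  sumn s <= \sum_(x <- s) (x - k) + size s * k.
Proof.
elim: s => [|x s IHs]; first by rewrite big_nil.
rewrite big_cons /= mulSn addnACA leq_add //.
by rewrite addnC -leq_subLR.
Qed.

Lemma sumn_eq_excess k (s : seq nat) : all (leq k) s ->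
  sumn s = \sum_(x <- s) (x - k) + size s * k.
Proof.
elim: s => [|x s IHs] /=; first by rewrite big_nil.
by case/andP=> kx /IHs->; rewrite big_cons mulSn addnACA subnK.
Qed.

(* The prefix sum of length [j] of [mu] is read off from the number of boxes
   beyond column [k := mu_j]. *)
Lemma dominates_excess lam mu : is_partition mu -> sumn lam = sumn mu ->
  (forall k, \sum_(x <- lam) (x - k) <= \sum_(x <- mu) (x - k)) ->
  dominates lam mu.
Proof.
case/andP=> smu _ eqs le_ex; split=> // j.
have trg : transitive geq by move=> y x z /= yx zy; apply: leq_trans zy yx.
pose k := nth 0 mu j.
(* Rows of [mu] from index [j] on have length at most [k], and those before it at least [k]. *)
have dropk : \sum_(x <- drop j mu) (x - k) = 0.
  rewrite big1_seq // => x /andP[_] /(nthP 0)[i]; rewrite size_drop nth_drop => li <-.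
  apply/eqP; rewrite subn_eq0; apply: (sorted_leq_nth trg (fun y => leqnn y) 0 smu).
  - by rewrite inE; rewrite ltn_subRL in li; apply: leq_ltn_trans li; rewrite leq_addr.
  - by rewrite inE -ltn_subRL.
  - exact: leq_addr.
have takek : \sum_(x <- take j mu) (x - k) + j * k <= sumn (take j mu).
  (* If [j] is past the end of [mu], the default value of [nth] gives [k = 0]. *)
  case: (leqP (size mu) j) => [lej|ltj].
    rewrite /k nth_default // muln0 addn0.
    by rewrite [leqRHS](@sumn_eq_excess 0) ?muln0 ?addn0 //; apply/allP.
  rewrite [leqRHS](@sumn_eq_excess k) ?size_takel ?(ltnW ltj) //.
  apply/allP=> x /(nthP 0)[i]; rewrite size_takel ?(ltnW ltj) // => li <-.
  rewrite nth_take //; apply: (sorted_leq_nth trg (fun y => leqnn y) 0 smu);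
    rewrite ?inE ?(ltnW li) //; exact: ltn_trans li ltj.
apply: leq_trans takek; apply: leq_trans (sumn_le_excess k _) _.
have := le_ex k; rewrite -{1}(cat_take_drop j lam) -{1}(cat_take_drop j mu) !big_cat /=.
rewrite dropk addn0 => /(leq_trans (leq_addr _ _)) le_take.
by apply: leq_add => //; rewrite leq_mul2r size_take_min geq_minl orbT.
Qed.

Lemma eq_prefix_sums lam mu : all (fun x => 0 < x) lam -> all (fun x => 0 < x) mu ->
  (forall k, sumn (take k lam) = sumn (take k mu)) -> lam = mu.
Proof.
elim: lam mu => [|a lam IHl] [|b mu] //=.
- by move=> _ /andP[b0 _] /(_ 1) /=; case: b b0.
- by move=> /andP[a0 _] _ /(_ 1) /=; case: a a0.
case/andP=> _ pl /andP[_ pm] eq_s.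
have ab : a = b by have := eq_s 1; rewrite /= !take0 /= !addn0.
congr (_ :: _) => //; apply: IHl => // k; have := eq_s k.+1; rewrite /= ab.
exact: addnI.
Qed.

Lemma dominates_anti lam mu : is_partition lam -> is_partition mu ->
  dominates lam mu -> dominates mu lam -> lam = mu.
Proof.
case/andP=> _ pl /andP[_ pm] [_ lm] [_ ml]; apply: eq_prefix_sums => // k.
by apply/eqP; rewrite eqn_leq lm ml.
Qed.

End Dominance.

(** * Existence and uniqueness of the nilpotent Jordan form *)

Section JordanForm.

Variable F : fieldType.

Lemma rank_factorization m n (A : 'M[F]_(m, n)) :
  exists (P : 'M_(m, \rank A)) (Q : 'M_(\rank A, n)) L R,
    [/\ P *m Q = A, L *m P = 1%:M & Q *m R = 1%:M].
Proof.
have [L LP] := row_fullP (col_base_full A).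
have [R QR] := row_freeP (row_base_free A).
by exists (col_base A), (row_base A), L, R; split=> //; apply: mulmx_base.
Qed.

(** Pick a nonzero entry [(i, j)] of [M ^+ a]. The rows [e_i M^p] form [B] and the columns
    [M^(a-q) e_j] form [C]; [M] acts on both by the shift, and [B *m C] is invertible, so the cyclic
    block is a direct summand. *)
Lemma cyclic_block_splits n (M : 'M[F]_n) a : M ^+ a.+1 = 0 -> M ^+ a != 0 ->
  exists (B : 'M[F]_(a.+1, n)) (C : 'M[F]_(n, a.+1)),
    [/\ B *m C = 1%:M, B *m M = shiftmx F a.+1 1 *m B
      & M *m C = C *m shiftmx F a.+1 1].
Proof.
move=> Ma1 Ma.
have [i [j Mij]] : exists i j, (M ^+ a) i j != 0.
  case: (pickP (fun ij => (M ^+ a) ij.1 ij.2 != 0)) => [ij|none].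
    by exists ij.1, ij.2.
  case/eqP: Ma; apply/matrixP=> i j; have := none (i, j); rewrite mxE /=.
  by move/negbFE/eqP.
pose B := \matrix_(p < a.+1) row i (M ^+ p).
pose C := (\matrix_(q < a.+1) row j ((M ^+ (a - q))^T))^T.
have BE p y : B p y = (M ^+ p) i y by rewrite !mxE.
have CE y q : C y q = (M ^+ (a - q)) y j by rewrite !mxE.
have BM : B *m M = shiftmx F a.+1 1 *m B.
  apply/row_matrixP=> p; rewrite row_mul rowK -row_mul mulmxE -exprSr.
  apply/rowP=> y; rewrite !mxE.
  case: (ltnP p.+1 a.+1) => [ltp|lea].
    rewrite (bigD1 (Ordinal ltp)) //= !BE !mxE /= addn1 eqxx mul1r big1 ?addr0 //.
    by move=> l /negPf nl; rewrite mxE addn1 -[(l : nat) == _]/(l == Ordinal ltp) nl mul0r.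
  rewrite big1 => [|l _]; last by rewrite mxE addn1 ltn_eqF ?mul0r // (leq_trans (ltn_ord l)).
  by rewrite (nilmx_leq lea Ma1) mxE.
have MC : M *m C = C *m shiftmx F a.+1 1.
  apply/matrixP=> y q.
  have -> : (M *m C) y q = (M ^+ (a - q).+1) y j.
    by rewrite exprS -mulmxE !mxE; apply: eq_bigr => l _; rewrite CE.
  rewrite [RHS]mxE; case: (posnP q) => [q0|q0].
    rewrite q0 subn0 Ma1 mxE big1 // => l _.
    by rewrite [shiftmx _ _ _ _ _]mxE q0 addn1 mulr0.
  have ltq : (q.-1 < a.+1)%N by rewrite (leq_ltn_trans (leq_pred _)).
  rewrite (bigD1 (Ordinal ltq)) //= CE [shiftmx _ _ _ _ _]mxE /= addn1 prednK // eqxx mulr1 big1 ?addr0.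
    suff -> : (a - q).+1 = (a - q.-1)%N by [].
    by rewrite -subSn ?leq_ord // -{1}(prednK q0) subSS.
  move=> l /negPf nl; rewrite [shiftmx _ _ _ _ _]mxE addn1.
  have -> : ((q : nat) == l.+1) = false; last by rewrite mulr0.
  rewrite -{1}(prednK q0) eqSS eq_sym.
  by move: nl; rewrite -[l == _]/((l : nat) == q.-1).
(* [H] is upper triangular with constant diagonal [(M ^+ a) i j], and it commutes
   with the shift; so [B] can be normalized by [invmx H]. *)
pose H := B *m C.
have HE p q : H p q = (M ^+ (p + (a - q))) i j.
  by rewrite exprD -mulmxE !mxE; apply: eq_bigr => l _; rewrite BE CE.
have uH : H \in unitmx.
  rewrite unitmxE -det_tr det_trig.
    rewrite unitfE prodf_seq_neq0; apply/allP => p _ /=.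
    by rewrite mxE HE subnKC ?leq_ord.
  apply/is_trig_mxP => p q ltpq; rewrite mxE HE.
  rewrite (nilmx_leq _ Ma1) ?mxE // -[ltnLHS](subnKC (leq_ord p)).
  by rewrite ltn_add2r.
exists (invmx H *m B), C; split=> //; first by rewrite -mulmxA mulVmx.
rewrite -mulmxA BM; apply: (can_inj (mulKmx uH)).
rewrite mulKVmx // [H *m _]mulmxA.
suff -> : H *m shiftmx F a.+1 1 = shiftmx F a.+1 1 *m H.
  by rewrite -[RHS]mulmxA mulKVmx.
by rewrite /H -mulmxA -MC mulmxA BM mulmxA.
Qed.

(** Induction on [n]: a cyclic block of maximal size splits off, and the rest is nilpotent of no
    larger index. The bound on the parts is carried along so that the new part can be put in front
    of a sorted list. *)
Lemma jordan_form_bounded n (M : 'M[F]_n) a : M ^+ a = 0 ->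
  exists lam, is_JF M lam /\ all (fun x => x <= a)%N lam.
Proof.
elim/ltn_ind: n M a => n IHn M a0 Ma0.
have [n0|n_gt0] := posnP n.
  exists [::]; split=> //; split=> //; exists (const_mx 0), (const_mx 0).
  by split; last split; apply/matrixP; [subst n => -[] | move=> -[] | subst n => -[]].
pose ex_nil := ex_intro (fun k => M ^+ k == 0) a0 (introT eqP Ma0).
(* From here [a.+1] is the exact nilpotency index; index zero would make the identity vanish
   although [n] is positive. *)
case: (ex_minnP ex_nil) => -[|a] /eqP Ma min_a.
  have : \rank (M ^+ 0) = 0%N by rewrite Ma mxrank0.
  by rewrite expr0 mxrank1 => n0; rewrite n0 in n_gt0.
have le_a : (a < a0)%N by apply: min_a; apply/eqP.
have Ma' : M ^+ a != 0 by apply/negP => /min_a; rewrite ltnn.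
have [B [C [BC BM MC]]] := cyclic_block_splits Ma Ma'.
(* [e] is an idempotent commuting with [M] that kills the cyclic block; its rank factorization gives
   coordinates on the complement. *)
pose e := 1%:M - C *m B.
have [P2 [Q2 [L [R [PQ2 LP QR]]]]] := rank_factorization e.
have Be : B *m e = 0 by rewrite mulmxBr mulmx1 mulmxA BC mul1mx subrr.
have eC : e *m C = 0 by rewrite mulmxBl mul1mx -mulmxA BC mulmx1 subrr.
have ee : e *m e = e by rewrite {1}/e mulmxBl mul1mx -mulmxA Be mulmx0 subr0.
have injQ m' (X Y : 'M_(m', _)) : X *m Q2 = Y *m Q2 -> X = Y.
  by move=> /(congr1 (mulmxr R)) /=; rewrite -!mulmxA QR !mulmx1.
have injP m' (X Y : 'M_(_, m')) : P2 *m X = P2 *m Y -> X = Y.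
  by move=> /(congr1 (mulmx L)); rewrite !mulmxA LP !mul1mx.
have BP2 : B *m P2 = 0 by apply: injQ; rewrite -mulmxA PQ2 Be mul0mx.
have Q2C : Q2 *m C = 0 by apply: injP; rewrite mulmxA PQ2 eC mulmx0.
have QP2 : Q2 *m P2 = 1%:M.
  by apply: injP; apply: injQ; rewrite mulmx1 mulmxA PQ2 -mulmxA PQ2 ee.
have Me : M *m e = e *m M.
  by rewrite /e mulmxBr mulmxBl mulmx1 mul1mx mulmxA MC -!mulmxA BM !mulmxA.
pose M2 := Q2 *m M *m P2.
have MP2 : M *m P2 = P2 *m M2.
  rewrite /M2 !mulmxA PQ2 -Me -!mulmxA; congr (_ *m _).
  by apply: injQ; rewrite -[_ *m P2 *m _]mulmxA PQ2 ee.
have M2a : M2 ^+ a.+1 = 0.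
  by apply: injP; rewrite -(exp_intertwine _ MP2) Ma mul0mx mulmx0.
pose P := row_mx C P2; pose Q := col_mx B Q2.
have PQ : P *m Q = 1%:M by rewrite mul_row_col PQ2 addrC subrK.
have QP : Q *m P = 1%:M.
  by rewrite mul_col_row BC BP2 Q2C QP2 -scalar_mx_block.
have ltr : (\rank e < n)%N.
  by apply: leq_trans (mulmx1_min QP); rewrite addSn ltnS leq_addl.
have [lam [[plam [P' [Q' [PQ' [QP' M2E]]]]] /allP le_lam]] := IHn _ ltr M2 a.+1 M2a.
have ME : M = P *m block_mx (shiftmx F a.+1 1) 0 0 M2 *m Q.
  rewrite mul_row_block !mulmx0 addr0 add0r -MC -MP2 mul_row_col -!mulmxA PQ2.
  by rewrite -mulmxDr addrC subrK mulmx1.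
exists (a.+1 :: lam); split; last first.
  by rewrite /= le_a; apply/allP => x /le_lam /leq_trans; apply.
split.
  case/andP: plam => slam pos; rewrite /is_partition /= pos andbT.
  case: lam slam le_lam {pos P' Q' PQ' QP' M2E} => //= b lam -> -> //.
  by rewrite inE eqxx.
exists (P *m (block_mx 1%:M 0 0 P' : 'M_(_, a.+1 + sumn lam))).
exists ((block_mx 1%:M 0 0 Q' : 'M_(a.+1 + sumn lam, _)) *m Q); split; last split.
- rewrite mulmxA -(mulmxA P) mulmx_block !(mulmx0, mul0mx, addr0, add0r, mulmx1).
  by rewrite PQ' -scalar_mx_block mulmx1.
- rewrite mulmxA -(mulmxA _ Q) QP mulmx1 mulmx_block !(mulmx0, mul0mx, addr0, add0r, mulmx1).
  by rewrite QP' -scalar_mx_block.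
- rewrite {1}ME M2E jordan_nil_cons.
  have -> : block_mx (shiftmx F a.+1 1) 0 0 (P' *m jordan_nil F lam *m Q') =
     block_mx 1%:M 0 0 P' *m block_mx (shiftmx F a.+1 1) 0 0 (jordan_nil F lam)
       *m block_mx 1%:M 0 0 Q'.
    by rewrite !mulmx_block !(mulmx0, mul0mx, addr0, add0r, mulmx1, mul1mx).
  by rewrite !mulmxA.
Qed.

Lemma jordan_form n (M : 'M[F]_n) : nilmx M -> exists lam, is_JF M lam.
Proof. by case=> a /jordan_form_bounded[lam [JM _]]; exists lam. Qed.

Lemma nilmx_exp_dim n (M : 'M[F]_n) : nilmx M -> M ^+ n = 0.
Proof. by case/jordan_form=> lam /is_JF_nil. Qed.

Lemma nilmx_strict_trig n (M : 'M[F]_n) : nilmx M ->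
  exists2 g : 'M[F]_n, g \in unitmx & strict_trigmx (g *m M *m invmx g).
Proof.
case/jordan_form=> lam JM; have n_lam := is_JF_sumn JM.
case: JM => _ [P [Q [PQ [QP ->]]]]; have := @jordan_nil_strict_trig F lam.
move: (jordan_nil F lam) => J tJ; subst n.
have [uP uQ] := mulmx1_unit PQ; exists Q => //.
have -> : invmx Q = P by rewrite -[LHS]mul1mx -PQ mulmxK.
by rewrite !mulmxA QP mul1mx -mulmxA QP mulmx1.
Qed.

Lemma dominates_rank n (M N : 'M[F]_n) lam mu : is_JF M lam -> is_JF N mu ->
  (forall k, \rank (M ^+ k) <= \rank (N ^+ k))%N -> dominates lam mu.
Proof.
move=> JM JN leMN; apply: dominates_excess; first by case: JN.
  by rewrite (is_JF_sumn JM) (is_JF_sumn JN).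
by move=> k; rewrite -(rank_exp_JF k JM) -(rank_exp_JF k JN).
Qed.

Lemma is_JF_rank n (M N : 'M[F]_n) mu : nilmx M -> is_JF N mu ->
  (forall k, \rank (M ^+ k) = \rank (N ^+ k)) -> is_JF M mu.
Proof.
case/jordan_form=> lam JM JN eqr.
suff <- : lam = mu by [].
apply: dominates_anti; [by case: JM | by case: JN | |].
  by apply: dominates_rank JM JN _ => k; rewrite eqr.
by apply: dominates_rank JN JM _ => k; rewrite eqr.
Qed.

End JordanForm.

(** * Subalgebras of matrix algebras *)

Lemma ex_maximizer (T : Type) (P : T -> Prop) (f : T -> nat) b :
  (exists x, P x) -> (forall x, P x -> f x <= b)%N ->
  exists2 x, P x & forall y, P y -> (f y <= f x)%N.
Proof.
case=> x Px fb; have [k] := ubnP (b - f x)%N.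
elim: k x Px => // k IHk x Px lt_k.
case: (classic (exists2 y, P y & (f x < f y)%N)) => [[y Py lt_xy]|none].
  apply: (IHk y Py); rewrite -ltnS; apply: leq_trans lt_k; rewrite ltnS.
  by apply: ltn_sub2l => //; apply: leq_trans lt_xy (fb _ Py).
by exists x => // y Py; rewrite leqNgt; apply/negP => lt_xy; apply: none; exists y.
Qed.

Section MatrixAlgebras.

Variable F : fieldType.

(** A matrix of maximal rank among those with row space inside [V] spans [V], as adjoining one more
    vector of [V] cannot raise its rank. *)
Lemma subspace_mx n (V : 'rV[F]_n -> Prop) :
  V 0 -> (forall a u v, V u -> V v -> V (a *: u + v)) ->
  exists U : 'M[F]_n, forall v, V v <-> (v <= U)%MS.
Proof.
move=> V0 Vlin.
have [||U VU maxU] := @ex_maximizer 'M[F]_n (fun U => forall v, (v <= U)%MS -> V v) mxrank n.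
- by exists 0 => v; rewrite submx0 => /eqP->.
- by move=> U _; apply: rank_leq_col.
exists U => v; split=> [Vv|]; last exact: VU.
have Uv w : (w <= U + v)%MS -> V w.
  case/sub_addsmxP=> -[u c] /= ->; rewrite [c]mx11_scalar mul_scalar_mx addrC.
  by apply: Vlin => //; apply: VU; apply: submxMl.
have := maxU _ Uv; rewrite (geq_leqif (mxrank_leqif_sup (addsmxSl U v))).
exact: submx_trans (addsmxSr U v).
Qed.

Definition subalgebra n (A : 'M[F]_n -> Prop) :=
  [/\ A 1%:M, forall a x y, A x -> A y -> A (a *: x + y)
    & forall x y, A x -> A y -> A (x *m y)].

Lemma subalgebra0 n (A : 'M[F]_n -> Prop) : subalgebra A -> A 0.
Proof. by case=> A1 Al _; rewrite -[0](addNr (1%:M)) -scaleN1r; apply: Al. Qed.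

Lemma subalgebraZ n (A : 'M[F]_n -> Prop) a x : subalgebra A -> A x -> A (a *: x).
Proof. by move=> sA Ax; case: (sA) => _ Al _; rewrite -[_ *: _]addr0; apply: Al => //; apply: subalgebra0. Qed.

Lemma subalgebraD n (A : 'M[F]_n -> Prop) x y : subalgebra A -> A x -> A y -> A (x + y).
Proof. by case=> _ Al _ Ax Ay; rewrite -[x]scale1r; apply: Al. Qed.

Lemma subalgebraB n (A : 'M[F]_n -> Prop) x y : subalgebra A -> A x -> A y -> A (x - y).
Proof. by case=> _ Al _ Ax Ay; rewrite addrC -scaleN1r; apply: Al. Qed.

Lemma subalgebraX n (A : 'M[F]_n -> Prop) x k : subalgebra A -> A x -> A (x ^+ k).
Proof.
case=> A1 _ AM Ax; elim: k => [|k IHk]; first by rewrite expr0.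
by rewrite exprS -mulmxE; apply: AM.
Qed.

(** A nonzero entry [T i j] yields every matrix unit, since [delta_mx k i *m T *m delta_mx j l] is
    [T i j] times [delta_mx k l]. *)
Lemma ideal_mx_full n (I : 'M[F]_n -> Prop) (T : 'M[F]_n) :
  (forall x y, I x -> I y -> I (x + y)) ->
  (forall M x, I x -> I (M *m x)) -> (forall M x, I x -> I (x *m M)) ->
  I T -> T != 0 -> forall M, I M.
Proof.
move=> ID IMl IMr IT T0 M.
have [i [j Tij]] : exists i j, T i j != 0.
  case: (pickP (fun ij => T ij.1 ij.2 != 0)) => [ij|none]; first by exists ij.1, ij.2.
  by case/eqP: T0; apply/matrixP=> i j; have /negbFE/eqP := none (i, j); rewrite mxE.
rewrite (matrix_sum_delta M).
have I0 : I 0 by rewrite -(mul0mx _ T); apply: IMl.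
apply: (big_ind I) => // k _; apply: (big_ind I) => // l _.
have -> : M k l *: delta_mx k l =
    ((M k l / T i j) *: delta_mx k i) *m T *m delta_mx j l.
  rewrite -!scalemxAl; have -> : delta_mx k i *m T *m delta_mx j l = T i j *: delta_mx k l.
    apply/matrixP=> u v; rewrite mxE (bigD1 j) //= big1 => [|w /negPf nw].
      rewrite addr0 !mxE (bigD1 i) //= big1 => [|w /negPf nw].
        by rewrite addr0 !mxE !eqxx andbT /= mulrAC -natrM mulnb mulrC.
      by rewrite !mxE nw andbF mul0r.
    by rewrite [delta_mx _ _ _ _]mxE nw mulr0.
  by rewrite scalerA mulfVK.
by apply: IMr; apply: IMl.
Qed.

End MatrixAlgebras.

(* A nonzero element of minimal rank has rank one: if [x1 T], [x2 T] are
   independent and [x1 T a = x2], then [T (a T - c)] is nonzero for all [c], and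
   its rank drops when [c] is an eigenvalue of [a T] on the row space of [T]. *)
Theorem burnside (F : closedFieldType) n (A : 'M[F]_n -> Prop) : subalgebra A ->
  (forall U : 'M[F]_n, (forall x, A x -> (U *m x <= U)%MS) -> U = 0 \/ row_full U) ->
  forall M, A M.
Proof.
move=> sA irrA; case: (sA) => A1 Al AM.
have trans (v w : 'rV_n) : v != 0 -> exists2 x, A x & v *m x = w.
  (* The space of all [v *m x] with [x] in [A] is stable and contains [v], so it is everything. *)
  move=> v0.
  have [||U VU] := @subspace_mx F n (fun w => exists2 x, A x & v *m x = w).
  - by exists 0; rewrite ?mulmx0 //; apply: subalgebra0.
  - move=> a _ _ [x Ax <-] [y Ay <-]; exists (a *: x + y); first exact: Al.
    by rewrite mulmxDr scalemxAr.
  have vU : (v <= U)%MS by apply/VU; exists 1%:M; rewrite ?mulmx1.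
  have [x Ax|U0|fU] := irrA U.
  - apply/row_subP => i; rewrite row_mul; apply/VU.
    have /VU[y Ay <-] := row_sub i U.
    by exists (y *m x); rewrite ?mulmxA //; apply: AM.
  - by move: vU; rewrite U0 submx0 (negPf v0).
  - by apply/VU; apply: submx_full.
move=> M; case: (posnP n) => [n0|n_gt0].
  suff -> : M = 1%:M by []; by subst n; apply/matrixP => -[].
(* Minimal rank is obtained as maximal corank. *)
have [||T [AT T0] minT] := @ex_maximizer 'M[F]_n (fun T => A T /\ T != 0)
  (fun T => n - \rank T)%N n.
- by exists 1%:M; rewrite -mxrank_eq0 mxrank1 -lt0n.
- by move=> T _; apply: leq_subr.
have {}minT x : A x -> (\rank x < \rank T)%N -> x = 0.
  move=> Ax ltx; apply/eqP/negP => /negP x0; have := minT x (conj Ax x0).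
  rewrite leqNgt ltn_sub2l //; apply: leq_trans ltx _; exact: rank_leq_row.
have [i Ti] : exists i, row i T != 0.
  case: (pickP (fun i => row i T != 0)) => [i|none]; first by exists i.
  by case/eqP: T0; apply/row_matrixP => i; rewrite row0; apply/eqP/negbFE/none.
have T1 : (T <= row i T)%MS.
  apply/row_subP => j; apply: contraT => Tj.
  have [a Aa Ta] := trans _ (delta_mx 0 j) Ti.
  have [P [Q [L [R [PQ LP QR]]]]] := rank_factorization T.
  have r0 : (0 < \rank T)%N by rewrite lt0n mxrank_eq0.
  (* [Q *m (a *m P)] is the matrix of [a *m T] on the row space of [T] in the basis [Q]. *)
  have /closed_rootP[c] : size (char_poly (Q *m (a *m P))) != 1.
    by rewrite size_char_poly eqSS -lt0n.
  rewrite -eigenvalue_root_char => /eigenvalueP[v vE v0].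
  pose S := T *m (a *m T - c%:M).
  have AS : A S.
    apply: (AM) => //; rewrite -scalemx1 -scaleNr addrC.
    by apply: Al => //; apply: AM.
  have S0 : S = 0.
    apply: minT => //; rewrite -(mxrank_mul_ker T (a *m T - c%:M)) -[ltnLHS]addn0 ltn_add2l.
    rewrite lt0n mxrank_eq0; apply: contraNneq v0 => capT.
    have : (v *m Q <= T :&: kermx (a *m T - c%:M))%MS.
      rewrite sub_capmx; apply/andP; split.
        apply/submxP; exists (v *m L); rewrite -mulmxA; congr (v *m _).
        by rewrite -[LHS]mul1mx -LP -mulmxA PQ.
      apply/sub_kermxP; have -> : a *m T = a *m P *m Q by rewrite -mulmxA PQ.
      by rewrite mulmxBr mulmxA -(mulmxA v) vE -scalemxAl mul_mx_scalar subrr.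
    by rewrite capT submx0 => /eqP vQ; rewrite -[v]mulmx1 -QR mulmxA vQ mul0mx.
  case/negP: Tj; apply/sub_rVP; exists c.
  have : row i S = 0 by rewrite S0 row0.
  rewrite row_mul mulmxBr mulmxA Ta -rowE mul_mx_scalar => /eqP.
  by rewrite subr_eq0 => /eqP.
have [u Tu] : exists u : 'cV_n, T = u *m row i T by apply/submxP.
set w := row i T in Tu Ti.
have u0 : u != 0 by apply: contraNneq T0 => u0; rewrite Tu u0 mul0mx.
(* The rows [c] such that [A] contains all products [c^T *m x]; once they fill the space, [A]
   contains every matrix unit. *)
have [||U VU] := @subspace_mx F n (fun c => forall x : 'rV_n, A (c^T *m x)).
- by move=> x; rewrite trmx0 mul0mx; apply: subalgebra0.
- by move=> a c c' Ac Ac' x; rewrite linearP /= mulmxDl -scalemxAl; apply: Al.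
have uU x : A x -> ((x *m u)^T <= U)%MS.
  move=> Ax; apply/VU => y; rewrite trmxK; have [b Ab <-] := trans w y Ti.
  by rewrite mulmxA -(mulmxA x) -Tu; apply: (AM) => //; apply: (AM).
have fU : row_full U.
  (* A nonzero [z] annihilating all columns [x *m u] is carried by elements of [A] to every
     coordinate row, so each coordinate of [u] vanishes. *)
  rewrite /row_full -mxrank_tr -/(row_free U^T) -kermx_eq0; apply: contraT => /rowV0Pn[z].
  move/sub_kermxP => zU z0; case/eqP: u0; apply/matrixP => j k; rewrite ord1 mxE.
  have [x Ax zx] := trans z (delta_mx 0 j) z0.
  have : z *m (x *m u) = 0.
    case/submxP: (uU x Ax) => C xu; rewrite -[x *m u]trmxK xu trmx_mul mulmxA zU.
    exact: mul0mx.
  by rewrite mulmxA zx -rowE => /matrixP/(_ 0 0); rewrite !mxE.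
rewrite (matrix_sum_delta M).
apply: (big_ind A) => [|x y|k _]; [exact: subalgebra0 | exact: subalgebraD |].
apply: (big_ind A) => [|x y|l _]; [exact: subalgebra0 | exact: subalgebraD |].
apply: subalgebraZ => //; rewrite -(mul_delta_mx (0 : 'I_1)) -trmx_delta.
have /VU Ak : ((delta_mx 0 k : 'rV[F]_n) <= U)%MS by apply: submx_full.
exact: Ak.
Qed.

(** * Representations of [A], composition factors, and conjugation of nilpotents *)

Section Representations.

Variables (F : closedFieldType) (D : nat) (A : 'M[F]_D -> Prop).
Hypothesis sA : subalgebra A.

(** The map is total, with linearity and multiplicativity imposed only on [A], so that elements of
    [A] need no type of their own. *)
Record rep := Rep {
  rdim : nat;
  rep_fun :> 'M[F]_D -> 'M[F]_rdim;
  rep1 : rep_fun 1%:M = 1%:M;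
  replin : forall a x y, A x -> A y -> rep_fun (a *: x + y) = a *: rep_fun x + rep_fun y;
  repM : forall x y, A x -> A y -> rep_fun (x *m y) = rep_fun x *m rep_fun y }.

Definition rep_onto (p : rep) := forall M, exists2 x, A x & p x = M.

Let A1 : A 1%:M. Proof. by case: sA. Qed.
Let AM x y : A x -> A y -> A (x *m y). Proof. by case: sA => _ _; apply. Qed.
Let A0 : A 0. Proof. exact: subalgebra0. Qed.

Lemma repD (p : rep) x y : A x -> A y -> p (x + y) = p x + p y.
Proof. by move=> Ax Ay; rewrite -{1}[x]scale1r replin // scale1r. Qed.

Lemma rep0 (p : rep) : p 0 = 0.
Proof. by apply: (addrI (p 0)); rewrite -repD // !addr0. Qed.

Lemma repB (p : rep) x y : A x -> A y -> p (x - y) = p x - p y.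
Proof. by move=> Ax Ay; rewrite addrC -scaleN1r replin // scaleN1r addrC. Qed.

Lemma repX (p : rep) x k : A x -> p (x ^+ k) = p x ^+ k.
Proof.
move=> Ax; elim: k => [|k IHk]; first by rewrite !expr0 rep1.
by rewrite !exprS -!mulmxE repM ?IHk //; apply: subalgebraX.
Qed.

Lemma rep_nil (p : rep) x : A x -> nilmx x -> nilmx (p x).
Proof. by move=> Ax [k xk]; exists k; rewrite -repX // xk rep0. Qed.

Definition id_rep : rep := @Rep D id erefl (fun _ _ _ _ _ => erefl) (fun _ _ _ _ => erefl).

Section Compression.

Variables (p : rep) (r : nat) (L : 'M[F]_(r, rdim p)) (R : 'M[F]_(rdim p, r)).
Hypothesis LR : L *m R = 1%:M.
Hypothesis LMR : forall x y, A x -> A y ->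
  L *m (p x *m p y) *m R = (L *m p x *m R) *m (L *m p y *m R).

Lemma compress1 : L *m p 1%:M *m R = 1%:M.
Proof. by rewrite rep1 mulmx1. Qed.

Lemma compress_lin a x y : A x -> A y ->
  L *m p (a *: x + y) *m R = a *: (L *m p x *m R) + L *m p y *m R.
Proof. by move=> Ax Ay; rewrite replin // mulmxDr mulmxDl -scalemxAr -scalemxAl. Qed.

Lemma compressM x y : A x -> A y ->
  L *m p (x *m y) *m R = (L *m p x *m R) *m (L *m p y *m R).
Proof. by move=> Ax Ay; rewrite repM // LMR. Qed.

(** One construction for both the restriction to a stable subspace and the quotient by it; in either
    case stability gives the hypothesis [LMR]. *)
Definition compress_rep : rep := Rep compress1 compress_lin compressM.

End Compression.

Definition stable (p : rep) (U : 'M[F]_(rdim p)) := forall x, A x -> (U *m p x <= U)%MS.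

(** In a basis adapted to [U] the matrices [p x] are block triangular; the diagonal blocks are the
    restriction to [U] and the quotient by it. *)
Lemma reducible_rep (p : rep) (U : 'M[F]_(rdim p)) :
  stable U -> U <> 0 -> ~~ row_full U ->
  exists p1 p2 : rep, [/\ (rdim p1 < rdim p)%N, (rdim p2 < rdim p)%N
    & forall x, A x -> nilmx (p1 x) -> nilmx (p2 x) -> nilmx (p x)].
Proof.
move=> stU U0 nfU.
have [P [Q [L [R [PQ LP QR]]]]] := rank_factorization U.
have QE : Q = L *m U by rewrite -[LHS]mul1mx -LP -mulmxA PQ.
have Qst x : A x -> Q *m p x *m R *m Q = Q *m p x.
  move=> Ax; have /submxP[C CE] := stU x Ax.
  have -> : Q *m p x = L *m C *m P *m Q.
    by rewrite -(mulmxA _ P) PQ -mulmxA -CE mulmxA -QE.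
  by rewrite -(mulmxA _ Q R) QR mulmx1.
(* The idempotent [e] kills [U], and its rank factorization gives coordinates on the quotient by
   [U]. *)
pose e := 1%:M - R *m Q.
have [P' [Q' [L' [R' [PQ' LP' QR']]]]] := rank_factorization e.
have Qe : Q *m e = 0 by rewrite mulmxBr mulmx1 mulmxA QR mul1mx subrr.
have ee : e *m e = e by rewrite {1}/e mulmxBl mul1mx -mulmxA Qe mulmx0 subr0.
have QP' : Q' *m P' = 1%:M.
  have Le : L' *m e = Q' by rewrite -[RHS]mul1mx -LP' -mulmxA PQ'.
  have eR : e *m R' = P' by rewrite -[RHS]mulmx1 -QR' mulmxA PQ'.
  by rewrite -Le -eR -mulmxA [e *m (e *m _)]mulmxA ee mulmxA Le.
have P'st x : A x -> P' *m (Q' *m p x *m P') = p x *m P'.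
  move=> Ax; have eP' : e *m P' = P' by rewrite -[RHS]mulmx1 -QP' mulmxA PQ'.
  have QP0 : Q *m P' = 0 by rewrite -eP' mulmxA Qe mul0mx.
  have QpP : Q *m p x *m P' = 0 by rewrite -Qst // -mulmxA QP0 mulmx0.
  rewrite !mulmxA PQ' [e *m _]mulmxBl mul1mx mulmxBl -(mulmxA R) -(mulmxA R) QpP.
  by rewrite mulmx0 subr0.
have M1 x y : A x -> A y -> Q *m (p x *m p y) *m R = (Q *m p x *m R) *m (Q *m p y *m R).
  by move=> Ax Ay; rewrite !mulmxA Qst.
have M2 x y : A x -> A y -> Q' *m (p x *m p y) *m P' = (Q' *m p x *m P') *m (Q' *m p y *m P').
  by move=> Ax Ay; rewrite -[LHS]mulmxA -(mulmxA (p x)) -P'st // !mulmxA.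
exists (compress_rep QR M1), (compress_rep QP' M2); split.
- by rewrite /= ltn_neqAle rank_leq_col andbT.
- rewrite /= ltn_neqAle rank_leq_row andbT; apply/negP => fe.
  have /row_freeP[e' ee'] : row_free e by [].
  case: U0; suff Q0 : Q = 0 by rewrite -PQ Q0 mulmx0.
  by rewrite -[Q]mulmx1 -ee' mulmxA Qe mul0mx.
move=> x Ax [k /= p1k] [l /= p2l].
have Qk : Q *m p x ^+ k = 0.
  by rewrite -(@exp_intertwine _ _ _ _ (Q *m p x *m R)) ?p1k ?mul0mx // Qst.
have Pl : p x ^+ l *m P' = 0.
  by rewrite (@exp_intertwine _ _ _ _ _ (Q' *m p x *m P')) ?p2l ?mulmx0 // P'st.
(* [p x ^+ l] maps everything into [U], where [p x ^+ k] vanishes. *)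
exists (l + k)%N; rewrite exprD -mulmxE -[p x ^+ l]mulmx1.
have -> : 1%:M = e + R *m Q by rewrite subrK.
by rewrite -PQ' mulmxDr mulmxA Pl mul0mx add0r -!mulmxA Qk !mulmx0.
Qed.

(** Split along a stable subspace as long as a proper nonzero one exists; an irreducible
    representation is onto by [burnside]. *)
Lemma onto_composition_factors (p : rep) : exists s : seq rep,
  (forall q, In q s -> rep_onto q) /\
  (forall x, A x -> (forall q, In q s -> nilmx (q x)) -> nilmx (p x)).
Proof.
have [k] := ubnP (rdim p); elim: k p => // k IHk p lt_pk.
case: (classic (exists U : 'M_(rdim p), [/\ stable U, U <> 0 & ~~ row_full U])).
  case=> U [stU U0 nfU]; have [p1 [p2 [lt1 lt2 nil12]]] := reducible_rep stU U0 nfU.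
  have [s1 [o1 n1]] := IHk p1 (leq_trans lt1 lt_pk).
  have [s2 [o2 n2]] := IHk p2 (leq_trans lt2 lt_pk).
  exists (s1 ++ s2); split=> [q /in_app_iff[/o1|/o2] //|x Ax nx].
  by apply: nil12 => //; [apply: n1 | apply: n2] => // q qs; apply: nx; apply/in_app_iff; auto.
move=> irr; exists [:: p]; split=> [q /= [<-|//] |x Ax np]; last by apply: np; left.
apply: (@burnside F (rdim p) (fun M => exists2 x, A x & p x = M)) => [|U stU].
  split.
  - by exists 1%:M; rewrite ?rep1.
  - move=> a _ _ [x Ax <-] [y Ay <-]; exists (a *: x + y); last exact: replin.
    by case: sA => _ Al _; apply: Al.
  - by move=> _ _ [x Ax <-] [y Ay <-]; exists (x *m y); [apply: AM | apply: repM].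
case: (classic (U = 0)) => [|U0]; [by left | right; apply: contraT => nfU].
by case: irr; exists U; split=> // x Ax; apply: stU; exists x.
Qed.

(** Surjectivity onto the product of the matrix algebras. The factors have different sizes, so a
    target tuple is replaced by a family of conditions [G], each satisfiable separately. *)
Definition jointly_onto (s : seq rep) :=
  forall G : forall p : rep, 'M[F]_(rdim p) -> Prop,
    (forall p, In p s -> exists M, G p M) ->
    exists2 x, A x & forall p, In p s -> G p (p x).

(* A representation that vanishes on the common kernel of the others sees no
   nilpotency that they miss, so it can be dropped; otherwise it maps that
   kernel onto a nonzero two-sided ideal of a full matrix algebra. *)
Lemma jointly_onto_subfamily (s : seq rep) : (forall q, In q s -> rep_onto q) ->
  exists2 s', jointly_onto s' &
    forall x, A x -> (forall q, In q s' -> nilmx (q x)) ->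
      forall q, In q s -> nilmx (q x).
Proof.
elim: s => [|p s IHs] onto_s.
  by exists [::] => //; move=> G _; exists 0.
have [|s' onto_s' nil_s'] := IHs; first by move=> q qs; apply: onto_s; right.
pose K x := A x /\ forall q, In q s' -> q x = 0.
case: (classic (exists2 x, K x & p x <> 0)) => [[x0 Kx0 px0]|none]; last first.
  exists s' => // x Ax nx q /= [<-|qs]; last exact: nil_s' qs.
  (* A common exponent puts [x ^+ k] into [K], where [p] vanishes. *)
  have [k kx] : exists k, forall q', In q' s' -> q' x ^+ k = 0.
    elim: (s') nx => [|q' s'' IH] nx; first by exists 0%N.
    have [|k kx] := IH; first by move=> r rs; apply: nx; right.
    have [|l lx] := nx q'; first by left.
    exists (k + l)%N => r /= [<-|/kx rk].
      exact: nilmx_leq (leq_addl _ _) lx.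
    exact: nilmx_leq (leq_addr _ _) rk.
  exists k; rewrite -repX //; apply: NNPP => pk; apply: none; exists (x ^+ k) => //.
  by split=> [|r rs]; [apply: subalgebraX | rewrite repX // kx].
have onto_p : rep_onto p by apply: onto_s; left.
have K_onto M : exists2 x, K x & p x = M.
  apply: (@ideal_mx_full F _ (fun M => exists2 x, K x & p x = M) (p x0)).
  - move=> _ _ [x [Ax Kx] <-] [y [Ay Ky] <-]; exists (x + y); last exact: repD.
    by split=> [|q qs]; [apply: subalgebraD | rewrite repD // Kx // Ky // addr0].
  - move=> M' _ [x [Ax Kx] <-]; have [y Ay <-] := onto_p M'.
    exists (y *m x); last exact: repM.
    by split=> [|q qs]; [apply: AM | rewrite repM // Kx // mulmx0].
  - move=> M' _ [x [Ax Kx] <-]; have [y Ay <-] := onto_p M'.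
    exists (x *m y); last exact: repM.
    by split=> [|q qs]; [apply: AM | rewrite repM // Kx // mul0mx].
  - by exists x0.
  - exact/eqP.
exists (p :: s') => [G Gs|x Ax nx q /= [<-|qs]].
- have [|x Ax Gx] := onto_s' G; first by move=> q qs; apply: Gs; right.
  have [|M GM] := Gs p; first by left.
  (* Correct the [p] component by an element of [K], which leaves the other components alone. *)
  have [y [Ay Ky] py] := K_onto (M - p x).
  exists (x + y) => [|q /= [<-|qs]]; first exact: subalgebraD.
    by rewrite repD // py addrC subrK.
  by rewrite repD // Ky // addr0; apply: Gx.
- by apply: nx; left.
- by apply: nil_s' qs => // r rs; apply: nx; right.
Qed.

Lemma semisimple_quotient : exists2 s : seq rep, jointly_onto s &
  forall x, A x -> (forall q, In q s -> nilmx (q x)) -> nilmx x.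
Proof.
have [s [onto_s nil_s]] := onto_composition_factors id_rep.
have [s' onto_s' nil_s'] := jointly_onto_subfamily onto_s.
by exists s' => // x Ax nx; apply: (nil_s x Ax) => q; apply: nil_s'.
Qed.

Hypothesis AV : forall x, A x -> x \in unitmx -> A (invmx x).

Section Conjugation.

Variable s : seq rep.
Hypothesis onto_s : jointly_onto s.
Hypothesis nil_s : forall x, A x -> (forall q, In q s -> nilmx (q x)) -> nilmx x.

(** The preimage in [A] of the nilpotent radical of a Borel subalgebra; being linear, it can be
    traversed along straight lines. *)
Definition borel_nil x := A x /\ forall q, In q s -> strict_trigmx (q x).

Lemma borel_nil_lin a x y : borel_nil x -> borel_nil y -> borel_nil (a *: x + y).
Proof.
case=> Ax tx [Ay ty]; split=> [|q qs i j ij]; first by case: sA => _ Al _; apply: Al.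
by rewrite replin // !mxE tx // ty // mulr0 addr0.
Qed.

Lemma borel_nil_nil x : borel_nil x -> nilmx x.
Proof. by case=> Ax tx; apply: nil_s => // q qs; apply/strict_trigmx_nil/tx. Qed.

(** Lifting the inverses of all [q g] to one [h] makes [g *m h - 1%:M] vanish in every
    representation of [s], so it is nilpotent and [g *m h] is a unit. *)
Lemma unit_of_reps g : A g -> (forall q, In q s -> q g \in unitmx) -> g \in unitmx.
Proof.
move=> Ag ug; have [|h Ah hg] := onto_s (G := fun q M => q g *m M = 1%:M).
  by move=> q qs; exists (invmx (q g)); rewrite mulmxV ?ug.
have : g *m h \in unitmx; last by rewrite unitmx_mul => /andP[].
apply: nilmx_unit1; apply: nil_s => [|q qs]; first by apply: subalgebraB => //; apply: AM.
by exists 1%N; rewrite expr1 repB ?repM ?hg ?rep1 ?subrr //; apply: AM.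
Qed.

(** Triangularize each [q x] separately; joint surjectivity lifts the conjugating matrices to one
    [g] in [A]. *)
Lemma nil_conj_borel x : A x -> nilmx x ->
  exists2 g, A g /\ g \in unitmx & borel_nil (g *m x *m invmx g).
Proof.
move=> Ax nx.
have [|g Ag gE] := onto_s (G := fun q M => M \in unitmx /\ strict_trigmx (M *m q x *m invmx M)).
  move=> q qs; have [M uM tM] := nilmx_strict_trig (rep_nil q Ax nx).
  by exists M.
have ug : g \in unitmx by apply: unit_of_reps => // q /gE[].
exists g => //; split=> [|q qs]; first by apply: (AM); [apply: (AM) | apply: AV].
have [uqg tq] := gE q qs; rewrite !repM //; try (by apply: AV); try exact: AM.
suff -> : q (invmx g) = invmx (q g) by [].
rewrite -[RHS]mulmx1 -(rep1 q) -(mulmxV ug) repM ?mulKmx //; exact: AV.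
Qed.

End Conjugation.

Definition mx_eval (t : F) : 'M[{poly F}]_D -> 'M[F]_D := map_mx (horner_eval t).

(* The curve is [\adj g(t) *m n(t) *m g(t)], with [g] and [n] affine in [t]. *)
Lemma nilpotent_curve x y : A x -> A y -> nilmx x -> nilmx y ->
  exists (P : 'M[{poly F}]_D) (delta : {poly F}),
    [/\ delta != 0, mx_eval 0 P = x, mx_eval 1 P = y
      & forall t, delta.[t] != 0 -> A (mx_eval t P) /\ nilmx (mx_eval t P)].
Proof.
move=> Ax Ay nx ny; have [s onto_s nil_s] := semisimple_quotient.
have [g [Ag ug] bx] := nil_conj_borel onto_s nil_s Ax nx.
have [h [Ah uh] bY] := nil_conj_borel onto_s nil_s Ay ny.
set n := g *m x *m _ in bx; set m := h *m y *m _ in bY.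
(* Dividing by the determinants makes up for [\adj] in place of the inverse, so that the curve
   passes exactly through [x] and [y]. *)
pose n' := (\det g)^-1 *: n; pose m' := (\det h)^-1 *: m.
pose line (a b : 'M[F]_D) : 'M[{poly F}]_D := map_mx polyC a + 'X *: map_mx polyC (b - a).
have lineE t a b : mx_eval t (line a b) = t *: (b - a) + a.
  by apply/matrixP=> i j; rewrite !mxE /horner_eval !hornerE [LHS]addrC.
have adjE z : z \in unitmx -> \adj z = \det z *: invmx z.
  by move=> uz; rewrite /invmx uz scalerA mulrV ?scale1r // -unitmxE.
pose P := \adj (line g h) *m line n' m' *m line g h.
have PE t : mx_eval t P = \adj (t *: (h - g) + g) *m (t *: (m' - n') + n') *m (t *: (h - g) + g).
  by rewrite /mx_eval !map_mxM map_mx_adj -!/(mx_eval _ _) !lineE.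
have dE t : (\det (line g h)).[t] = \det (t *: (h - g) + g).
  by rewrite -lineE /mx_eval det_map_mx.
have end_pt z w : z \in unitmx ->
    \adj z *m ((\det z)^-1 *: (z *m w *m invmx z)) *m z = w.
  move=> uz; rewrite adjE // -scalemxAl -scalemxAr scalerA mulrV -?unitmxE // scale1r.
  by rewrite !mulmxA mulVmx // mul1mx -mulmxA mulVmx // mulmx1.
have b0 : borel_nil s 0.
  by split=> // q qs i j _; rewrite rep0 mxE.
have bn' : borel_nil s n' by rewrite -[n']addr0; apply: borel_nil_lin.
have bm' : borel_nil s m' by rewrite -[m']addr0; apply: borel_nil_lin.
(* Away from the zeros of this determinant the conjugating matrix is a unit; its value at [0] is
   [\det g]. *)
exists P, (\det (line g h)); split.
- apply: contraTneq ug => d0; rewrite unitmxE unitfE.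
  by have := dE 0; rewrite d0 horner0 scale0r add0r => <-; rewrite eqxx.
- by rewrite PE !scale0r !add0r end_pt.
- by rewrite PE !scale1r !subrK end_pt.
move=> t; rewrite dE PE; set z := t *: _ + _ => dz.
have uz : z \in unitmx by rewrite unitmxE unitfE.
have Az : A z by case: sA => _ Al _; apply: Al => //; apply: subalgebraB.
have bk : borel_nil s (t *: (m' - n') + n').
  apply: borel_nil_lin => //; rewrite addrC -scaleN1r; exact: borel_nil_lin.
set k := t *: _ + _ in bk *; rewrite adjE //.
have AzV := AV Az uz; have Ak : A k by case: bk.
split; first by apply: AM => //; apply: AM => //; apply: subalgebraZ.
(* The factor [\det z] left by the adjugate is absorbed into [k]. *)
have [l kl] := borel_nil_nil nil_s (borel_nil_lin (\det z) bk b0).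
rewrite addr0 in kl; exists l; rewrite -scalemxAl scalemxAr exp_conjmx ?mulVmx ?mulmxV //.
by rewrite kl mulmx0 mul0mx.
Qed.

End Representations.

(** * Nilpotent endomorphisms of a representation *)

Section PolynomialFunctions.

Variables (F : fieldType) (n : nat) (d : 'I_n -> nat).
Implicit Types (N : forall i : 'I_n, 'M[F]_(d i)).

Lemma polyfun_ext (f g : (forall i : 'I_n, 'M[F]_(d i)) -> F) :
  f =1 g -> is_polyfun f -> is_polyfun g.
Proof. by move=> fg; have -> : f = g by apply: functional_extensionality. Qed.

Lemma polyfun_sum (I : Type) (r : seq I) f :
  (forall i, is_polyfun (f i)) -> is_polyfun (fun N => \sum_(i <- r) f i N).
Proof.
move=> pf; elim: r => [|i r IHr].
  by apply: polyfun_ext (polyfun_const d 0) => N; rewrite big_nil.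
by apply: polyfun_ext (polyfun_add (pf i) IHr) => N; rewrite big_cons.
Qed.

Lemma polyfun_prod (I : Type) (r : seq I) f :
  (forall i, is_polyfun (f i)) -> is_polyfun (fun N => \prod_(i <- r) f i N).
Proof.
move=> pf; elim: r => [|i r IHr].
  by apply: polyfun_ext (polyfun_const d 1) => N; rewrite big_nil.
by apply: polyfun_ext (polyfun_mul (pf i) IHr) => N; rewrite big_cons.
Qed.

Definition is_polymx p q (G : (forall i : 'I_n, 'M[F]_(d i)) -> 'M[F]_(p, q)) :=
  forall i j, is_polyfun (fun N => G N i j).

Lemma polymx_mul p q r G H : @is_polymx p q G -> @is_polymx q r H ->
  is_polymx (fun N => G N *m H N).
Proof.
move=> pG pH i j; have := polyfun_sum (index_enum _) (fun k => polyfun_mul (pG i k) (pH k j)).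
by apply: polyfun_ext => N; rewrite mxE.
Qed.

Lemma polymx_const p q (M : 'M[F]_(p, q)) : is_polymx (fun=> M).
Proof. by move=> i j; apply: polyfun_const. Qed.

Lemma polymx_exp i k : is_polymx (fun N => N i ^+ k).
Proof.
elim: k => [|k IHk]; first exact: polymx_const.
have coord : is_polymx (fun N => N i) by move=> p q; apply: polyfun_coord.
move=> p q; have := polymx_mul coord IHk p q.
by apply: polyfun_ext => N; rewrite exprS -mulmxE.
Qed.

Lemma polyfun_det p G : @is_polymx p p G -> is_polyfun (fun N => \det (G N)).
Proof.
move=> pG; apply: polyfun_sum => s; apply: polyfun_mul; first exact: polyfun_const.
by apply: polyfun_prod => i; apply: pG.
Qed.

(** The matrix [L *m N' i ^+ k *m R] is square, of size the rank at [N]. Its determinant is [1] at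
    [N], and where it is nonzero the rank is at least that size. *)
Lemma rank_exp_lsc N i k : exists f, [/\ is_polyfun f, f N <> 0 &
  forall N', f N' <> 0 -> (\rank (N i ^+ k) <= \rank (N' i ^+ k))%N].
Proof.
have [P [Q [L [R [PQ LP QR]]]]] := rank_factorization (N i ^+ k).
exists (fun N' => \det (L *m N' i ^+ k *m R)); split.
- apply: polyfun_det; apply: polymx_mul; last exact: polymx_const.
  by apply: polymx_mul; [apply: polymx_const | apply: polymx_exp].
- have -> : L *m N i ^+ k = Q by rewrite -[RHS]mul1mx -LP -mulmxA PQ.
  by rewrite QR det1; apply/eqP/oner_neq0.
move=> N' /eqP; rewrite -unitfE -unitmxE => uN'.
by have := mulVmx uN'; rewrite !mulmxA => /mulmx1_min_rank.
Qed.

Lemma rank_exp_lsc_seq N (s : seq ('I_n * nat)) : exists f, [/\ is_polyfun f, f N <> 0 &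
  forall N', f N' <> 0 -> {in s, forall ik,
    \rank (N ik.1 ^+ ik.2) <= \rank (N' ik.1 ^+ ik.2)}%N].
Proof.
elim: s => [|[i k] s [f [pf fN fs]]].
  by exists (fun=> 1); split=> //; [apply: polyfun_const | apply/eqP/oner_neq0].
have [g [pg gN gs]] := rank_exp_lsc N i k.
exists (fun N' => g N' * f N'); split; first exact: polyfun_mul.
  by apply/eqP; rewrite mulf_neq0 //; apply/eqP.
move=> N' /eqP; rewrite mulf_eq0 negb_or => /andP[/eqP gN' /eqP fN'] ik.
by rewrite inE => /predU1P[->|/(fs _ fN')//]; apply: gs.
Qed.

(** Nilpotency kills all powers from [\sum_i d i] on, so finitely many rank conditions suffice. *)
Lemma rank_exp_lsc_all N : (forall i, nilmx (N i)) ->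
  exists f, [/\ is_polyfun f, f N <> 0 &
  forall N', f N' <> 0 -> forall i k, (\rank (N i ^+ k) <= \rank (N' i ^+ k))%N].
Proof.
move=> nN; have [f [pf fN fs]] :=
  rank_exp_lsc_seq N [seq (i, k) | i <- enum 'I_n, k <- iota 0 (\sum_i d i)].
exists f; split=> // N' fN' i k; case: (ltnP k (\sum_i d i)) => [ltk|lek].
  apply: (fs N' fN' (i, k)); apply/allpairsP; exists (i, k).
  by rewrite /= mem_enum mem_iota.
rewrite (nilmx_leq _ (nilmx_exp_dim (nN i))) ?mxrank0 //.
by apply: leq_trans lek; rewrite (bigD1 i) //= leq_addr.
Qed.

End PolynomialFunctions.

(** * Families of blocks as block diagonal matrices *)

Section BlockDiagonal.

Variables (F : fieldType) (n : nat) (d : 'I_n -> nat).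
Implicit Types (N M : forall i : 'I_n, 'M[F]_(d i)).

Lemma mul_mxdiag N M :
  (\mxdiag_i N i) *m (\mxdiag_i M i) = \mxdiag_i (N i *m M i).
Proof.
rewrite mul_mxdiag_mxblock; apply: eq_mxblock => i j.
case: (i =P j) => [<-|_]; last by rewrite mulmx0.
by rewrite !conform_mx_id.
Qed.

Lemma scale_mxdiag a N : a *: (\mxdiag_i N i) = \mxdiag_i (a *: N i).
Proof.
rewrite -mul_scalar_mx -mxdiagZ mul_mxdiag; apply: eq_mxdiag => i.
by rewrite mul_scalar_mx.
Qed.

Lemma exp_mxdiag N k : (\mxdiag_i N i) ^+ k = \mxdiag_i (N i ^+ k).
Proof.
elim: k => [|k IHk]; first exact: (esym (mxdiagZ 1)).
by rewrite exprS IHk -mulmxE mul_mxdiag; apply: eq_mxdiag => i; rewrite exprS.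
Qed.

Lemma nilmx_mxdiag N : nilmx (\mxdiag_i N i) <-> exists k, forall i, N i ^+ k = 0.
Proof.
split=> -[k Nk]; exists k.
  move=> i; have := congr1 (fun x => submxblock x i i) Nk.
  by rewrite exp_mxdiag submxblock_diag => ->; apply/matrixP=> p q; rewrite !mxE.
by rewrite exp_mxdiag -mxdiag0; apply: eq_mxdiag.
Qed.

End BlockDiagonal.

(** * Irreducibility of the nilpotent endomorphisms and generic ranks *)

Section Endomorphisms.

Variables (F : closedFieldType) (n m : nat) (d : 'I_n -> nat).
Variable rho : 'I_m -> forall i j : 'I_n, 'M[F]_(d i, d j).
Implicit Types (N M : forall i : 'I_n, 'M[F]_(d i)).

(** Assembling the blocks makes the results on subalgebras of a single matrix algebra applicable. *)
Definition endo_mx (x : 'M[F]_(\sum_i d i)) :=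
  exists2 N, is_endo rho N & x = \mxdiag_i N i.

Lemma endo_mx_subalgebra : subalgebra endo_mx.
Proof.
split.
- exists (fun i => 1%:M); last by rewrite mxdiagZ.
  by move=> a i j; rewrite mulmx1 mul1mx.
- move=> a _ _ [N eN ->] [M eM ->]; exists (fun i => a *: N i + M i).
    by move=> b i j; rewrite mulmxDl mulmxDr -scalemxAl -scalemxAr eN eM.
  by rewrite scale_mxdiag -mxdiagD.
- move=> _ _ [N eN ->] [M eM ->]; exists (fun i => N i *m M i).
    by move=> b i j; rewrite mulmxA eN -mulmxA eM mulmxA.
  by rewrite mul_mxdiag.
Qed.

(** The diagonal blocks [Y i] of the inverse already invert the [N i], so they intertwine [rho] as
    well. *)
Lemma endo_mx_inv x : endo_mx x -> x \in unitmx -> endo_mx (invmx x).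
Proof.
case=> N eN -> uN; pose Y i := submxblock (invmx (\mxdiag_i N i)) i i.
have NY i : N i *m Y i = 1%:M.
  have := mulmxV uN; rewrite -[invmx _]submxblockK mul_mxdiag_mxblock.
  move/(congr1 (fun x => submxblock x i i)); rewrite mxblockK => ->.
  by rewrite -mxdiagZ submxblock_diag.
have YN i : Y i *m N i = 1%:M by apply: mulmx1C.
exists Y.
  move=> a i j; rewrite -[LHS]mul1mx -(YN i) -!mulmxA; congr (_ *m _).
  by rewrite mulmxA -eN -mulmxA NY mulmx1.
apply: (can_inj (mulKmx uN)); rewrite mulmxV // mul_mxdiag -mxdiagZ.
by apply: eq_mxdiag => i; rewrite NY.
Qed.

Lemma NEnd_endo_mx N : NEnd rho N -> endo_mx (\mxdiag_i N i) /\ nilmx (\mxdiag_i N i).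
Proof. by case=> eN nN; split; [exists N | apply/nilmx_mxdiag]. Qed.

Lemma NEnd_nil N i : NEnd rho N -> nilmx (N i).
Proof. by case=> _ [k Nk]; exists k. Qed.

Lemma NEnd0 : NEnd rho (fun i => 0).
Proof. by split=> [a i j|]; [rewrite mulmx0 mul0mx | exists 1%N => i; rewrite expr1]. Qed.

Definition diag_blocks (x : 'M[F]_(\sum_i d i)) : forall i, 'M[F]_(d i) :=
  fun i => submxblock x i i.

Lemma diag_blocksK N : diag_blocks (\mxdiag_i N i) = N.
Proof. by apply: functional_extensionality_dep => i; rewrite /diag_blocks submxblock_diag. Qed.

Lemma polyfun_curve f (P : 'M[{poly F}]_(\sum_i d i)) : is_polyfun f ->
  exists p : {poly F}, forall t, f (diag_blocks (mx_eval t P)) = p.[t].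
Proof.
elim=> [c|i p q|g h _ [pg gE] _ [ph hE]|g h _ [pg gE] _ [ph hE]].
- by exists c%:P => t; rewrite hornerC.
- by exists (submxblock P i i p q) => t; rewrite /diag_blocks !mxE.
- by exists (pg + ph) => t; rewrite hornerD gE hE.
- by exists (pg * ph) => t; rewrite hornerM gE hE.
Qed.

(** Along the curve from [N] to [M], [f] and [g] become polynomials in one variable, nonzero because
    of their values at [0] and [1]; together with [delta] they have a common nonroot over an
    algebraically closed field. *)
Lemma NEnd_irreducible f g N M : is_polyfun f -> is_polyfun g ->
  NEnd rho N -> NEnd rho M -> f N <> 0 -> g M <> 0 ->
  exists N', [/\ NEnd rho N', f N' <> 0 & g N' <> 0].
Proof.
move=> pf pg /NEnd_endo_mx[eN nN] /NEnd_endo_mx[eM nM] /eqP fN /eqP gM.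
have [P [delta [delta0 P0 P1 Pt]]] :=
  nilpotent_curve endo_mx_subalgebra endo_mx_inv eN eM nN nM.
have [p pE] := polyfun_curve P pf; have [q qE] := polyfun_curve P pg.
have p0 : p != 0.
  by apply: contraNneq fN => p0; rewrite -(diag_blocksK N) -P0 pE p0 horner0.
have q0 : q != 0.
  by apply: contraNneq gM => q0; rewrite -(diag_blocksK M) -P1 qE q0 horner0.
have /closed_nonrootP[t] : p * q * delta != 0 by rewrite !mulf_neq0.
rewrite !rootM !negb_or -andbA => /and3P[/eqP pt /eqP qt dt].
have [[N' eN' PE] nP] := Pt t dt.
exists N'; split; [split=> // | |].
- by apply/nilmx_mxdiag; rewrite -PE.
- by rewrite -(diag_blocksK N') -PE pE.
- by rewrite -(diag_blocksK N') -PE qE.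
Qed.

(** Maximize the sum of the ranks. Given [M], irreducibility yields [N'] with ranks at least those
    of both [N] and [M]; by maximality they equal those of [N]. *)
Lemma NEnd_generic : exists2 N, NEnd rho N &
  forall M, NEnd rho M -> forall i k, (\rank (M i ^+ k) <= \rank (N i ^+ k))%N.
Proof.
pose K := (\sum_i d i)%N.
pose total N := (\sum_(i < n) \sum_(k < K) \rank (N i ^+ k))%N.
have [||N eN maxN] := @ex_maximizer _ (NEnd rho) total (\sum_(i < n) \sum_(k < K) d i).
- by exists (fun i => 0); apply: NEnd0.
- by move=> N _; apply: leq_sum => i _; apply: leq_sum => k _; apply: rank_leq_col.
exists N => // M eM i k.
have [f [pf fN fr]] := rank_exp_lsc_all (fun j => NEnd_nil j eN).
have [g [pg gM gr]] := rank_exp_lsc_all (fun j => NEnd_nil j eM).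
have [N' [eN' fN' gN']] := NEnd_irreducible pf pg eN eM fN gM.
case: (ltnP k K) => [ltk|lek]; last first.
  rewrite (nilmx_leq _ (nilmx_exp_dim (NEnd_nil i eM))) ?mxrank0 //.
  by apply: leq_trans lek; rewrite /K (bigD1 i) //= leq_addr.
apply: leq_trans (gr _ gN' i k) _.
have := maxN N' eN'; apply: contraLR; rewrite -!ltnNge => ltr.
rewrite /total (bigD1 i) //= (bigD1 (Ordinal ltk)) //=.
rewrite [ltnRHS](bigD1 i) //= [in ltnRHS](bigD1 (Ordinal ltk)) //=.
rewrite -addSn leq_add //; first rewrite -addSn leq_add //.
  by apply: leq_sum => l _; apply: fr.
by apply: leq_sum => j _; apply: leq_sum => l _; apply: fr.
Qed.

End Endomorphisms.

Theorem theorem2p3 (F : closedFieldType) (n m : nat) (d : 'I_n -> nat)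
    (src tgt : 'I_m -> 'I_n)
    (rho : 'I_m -> forall i j : 'I_n, 'M[F]_(d i, d j))
    (Hsupp : forall (a : 'I_m) (i j : 'I_n),
        (i != src a) || (j != tgt a) -> rho a i j = 0)
    (Hnil : exists L : nat, forall s : seq 'I_m, size s = L ->
        forall i j : 'I_n, path_act rho s i j = 0) :
  exists mu : 'I_n -> seq nat,
    (forall N, NEnd rho N ->
       forall i : 'I_n, exists lam, is_JF (N i) lam /\ dominates lam (mu i)) /\
    zopen_in (NEnd rho) (fun N => NEnd rho N /\ forall i, is_JF (N i) (mu i)) /\
    zdense_in (NEnd rho) (fun N => NEnd rho N /\ forall i, is_JF (N i) (mu i)).
Proof.
have [G eG maxG] := NEnd_generic rho.
have [mu muG] : exists mu : 'I_n -> seq nat, forall i, is_JF (G i) (mu i).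
  apply: (fin_all_exists (P := fun i => is_JF (G i))) => i.
  exact: jordan_form (NEnd_nil i eG).
have JF_rank N : NEnd rho N ->
    (forall i k, \rank (G i ^+ k) <= \rank (N i ^+ k))%N -> forall i, is_JF (N i) (mu i).
  move=> eN leGN i; apply: (is_JF_rank (NEnd_nil i eN) (muG i)) => k.
  by apply/eqP; rewrite eqn_leq maxG ?leGN.
have rank_JF (N : forall i, 'M[F]_(d i)) : (forall i, is_JF (N i) (mu i)) ->
    forall i k, \rank (G i ^+ k) = \rank (N i ^+ k).
  by move=> JN i k; rewrite (rank_exp_JF k (muG i)) (rank_exp_JF k (JN i)).
exists mu; split; last split.
- move=> N eN i; have [lam JN] := jordan_form (NEnd_nil i eN).
  exists lam; split=> //; apply: dominates_rank JN (muG i) _ => k; exact: maxG.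
(* The open set is cut out by all polynomial functions that are nonzero on [NEnd rho] only at points
   of type [mu]; the function from [rank_exp_lsc_all] at each such point shows that they cover
   it. *)
- exists (fun f => is_polyfun f /\
    forall N, NEnd rho N -> f N <> 0 -> forall i, is_JF (N i) (mu i)).
  split=> [f []//|N]; split=> [[eN JN]|[eN [f [[_ fJ] fN]]]]; last first.
    by split=> //; apply: fJ.
  split=> //; have [f [pf fN fr]] := rank_exp_lsc_all (fun j => NEnd_nil j eN).
  exists f; split=> //; split=> // N' eN' fN'; apply: JF_rank => // i k.
  by rewrite (rank_JF N JN); apply: fr.
(* A function [g] that is nonzero at a point of [W] and the rank function [f] at [G] have a common
   point of nonvanishing by irreducibility. *)
- split=> [N []//|W [S [pS WE]] [N /WE[eN [g [Sg gN]]]]].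
  have [f [pf fG fr]] := rank_exp_lsc_all (fun j => NEnd_nil j eG).
  have [N' [eN' gN' fN']] := NEnd_irreducible (pS g Sg) pf eN eG gN fG.
  exists N'; split; first by apply/WE; split=> //; exists g.
  by split=> //; apply: JF_rank => // i k; apply: fr.
Qed.
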